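(* Let $(E,\mathcal{E})$ be a measurable space and let $k\in\mathbb{N}$. For each $n\in\mathbb{N}_{>k}$ let $n'\in\mathbb{N}_{>k}$ (depending on $n$), let $\Omega_n\subseteq E^{n'}$, let $\mathcal{F}_n$ be the sigma-algebra on $\Omega_n$ induced by the product sigma-algebra $\mathcal{E}_{n'}$ on $E^{n'}$, and let $\nu_n$ be a probability measure on $(\Omega_n,\mathcal{F}_n)$. Let $\mathbb{P}$ be a probability measure on $(E^k,\mathcal{E}_k)$ such that $$\lim_{n\to\infty}\nu_n(B)=\mathbb{P}(B)\quad\text{for all } B\in\mathcal{E}_k.$$ Let $f\colon E^k\to\mathbb{R}$ be measurable. Consider the conditions: (1) $f$ is integrable on $(\Omega_n,\nu_n)$ for all large $n\in\mathbb{N}$, and $$\lim_{m\to\infty}\lim_{n\to\infty}\int_{\Omega_n\cap\{|f|\ge m\}}|f|\,d\nu_n=0.$$ (2) $f$ is $\mathbb{P}$-integrable and $\lim_{n\to\infty}\int_{\Omega_n}f\,d\nu_n=\int_{E^k}f\,d\mathbb{P}$. Then (1) implies (2). Furthermore, if $f$ is nonnegative, then (1) and (2) are equivalent.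
   Context: For $j\in\mathbb{N}$, $\mathcal{E}_j$ denotes the product sigma-algebra on $E^j$. The sigma-algebra induced on $\Omega_n$ is $\{\Omega_n\cap A: A\in\mathcal{E}_{n'}\}$. For $B\in\mathcal{E}_k$, $\nu_n(B)$ denotes $\nu_n(\Omega_n\cap(B\times E^{n'-k}))$. A function $f$ on $E^k$ is regarded as a function on $\Omega_n\subseteq E^{n'}$ by composing it with the projection $E^{n'}\to E^k$ onto the first $k$ coordinates; integrals over $\Omega_n$, and the sets $\{|f|\ge m\}$ inside $\Omega_n$, are understood in this sense. Condition (1) includes the existence of the inner limits (for all large $m$) and of the outer limit. *)

(* Defs.v *)
From HB Require Import structures.
From mathcomp Require Import all_boot all_order all_algebra.
From mathcomp Require Import all_classical all_reals all_analysis.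

Set Implicit Arguments.
Unset Strict Implicit.
Unset Printing Implicit Defensive.

Import Order.TTheory GRing.Theory Num.Theory.
Import numFieldNormedType.Exports.

Local Open Scope classical_set_scope.
Local Open Scope ring_scope.

Definition natgt (k : nat) := {n : nat | (k < n)%N}.

Definition natgt_oo (k : nat) : set_system (natgt k) :=
  subset_filter \oo [set n : nat | (k < n)%N].
Arguments natgt_oo k : clear implicits.

(* Measurable types are pointed in the library, hence the nonemptiness
   argument; a set carrying a probability measure is never empty. *)
Definition trace_carrier (T : Type) (Omega : set T) (_ : Omega !=set0) : Type :=
  {x : T | x \in Omega}.

Definition trace_val (T : Type) (Omega : set T) (Omega0 : Omega !=set0)
  (x : trace_carrier Omega0) : T := sval x.

Section trace_pointed.
Context (T : choiceType) (Omega : set T) (Omega0 : Omega !=set0).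

HB.instance Definition _ := Choice.on (trace_carrier Omega0).

HB.instance Definition _ := isPointed.Build (trace_carrier Omega0)
  (exist _ (projT1 (cid Omega0)) (mem_set (projT2 (cid Omega0)))).

End trace_pointed.

(* Omega with the sigma-algebra of the sets Omega `&` A, A measurable; as
   subsets of the type of points of Omega these are the preimages of the A's
   under the inclusion. *)
Definition trace_space d (T : measurableType d) (Omega : set T)
    (Omega0 : Omega !=set0) :=
  g_sigma_algebra_preimageType (@trace_val T Omega Omega0).

Definition first_coords (T : Type) (k : nat) (j : natgt k)
    (x : (sval j).-tuple T) : k.-tuple T :=
  [tuple tnth x (widen_ord (ltnW (svalP j)) i) | i < k].

Definition trace_proj d (E : measurableType d) (k : nat) (j : natgt k)
    (Omega : set ((sval j).-tuple E)) (Omega0 : Omega !=set0)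
    (x : trace_space Omega0) : k.-tuple E :=
  first_coords (@trace_val _ Omega Omega0 x).
Arguments trace_proj {d E k j Omega} Omega0 x.

Section conditions.
Context d (E : measurableType d) (R : realType) (k : nat).
Variables (n' : natgt k -> natgt k).
Variables (Omega : forall n : natgt k, set ((sval (n' n)).-tuple E)).
Variables (Omega0 : forall n, @Omega n !=set0).
Variables (nu : forall n, probability (trace_space (Omega0 n)) R).
Variables (P : probability (k.-tuple E) R) (f : k.-tuple E -> R).

(* The library's [lim] is total, so that the existence of the inner limits has
   to be required separately. *)
Definition condition1 : Prop :=
  let tail m n :=
    (\int[nu n]_(x in [set x | (m%:R <= `|f (trace_proj (Omega0 n) x)|)%R])
       `|f (trace_proj (Omega0 n) x)|%:E)%E in
  [/\ \forall n \near natgt_oo k,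
        (nu n).-integrable setT (EFin \o f \o trace_proj (Omega0 n)),
      \forall m \near \oo, cvg (tail m n @[n --> natgt_oo k]) &
      lim (tail m n @[n --> natgt_oo k]) @[m --> \oo] --> 0%E].

Definition condition2 : Prop :=
  P.-integrable setT (EFin \o f) /\
  (\int[nu n]_x (f (trace_proj (Omega0 n) x))%:E)%E @[n --> natgt_oo k]
    --> (\int[P]_x (f x)%:E)%E.

End conditions.

(* Main.v *)
Require Import Defs.
From HB Require Import structures.
From mathcomp Require Import all_boot all_order all_algebra.
From mathcomp Require Import all_classical all_reals all_analysis.
From mathcomp Require Import finmap measurable_realfun lra.

Set Implicit Arguments.
Unset Strict Implicit.
Unset Printing Implicit Defensive.

Import Order.TTheory GRing.Theory Num.Theory.
Import numFieldNormedType.Exports.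

Local Open Scope classical_set_scope.
Local Open Scope ring_scope.

(* A lower bound for a limit inferior of integrals only needs convergence of the
   measures of the level sets of one simple function, so nu_n -> P setwise gives
   Fatou's inequality [\int f dP <= liminf \int f dnu_n] for f >= 0.  Applied to
   M + f and M - f it yields [\int f dnu_n -> \int f dP] whenever |f| <= M.  A
   general f is cut at level m: the part {|f| < m} is bounded, and the part
   {|f| >= m} is small for nu_n by (1), hence for P by Fatou.  Conversely, for
   f >= 0, the tail of nu_n is the total integral minus the integral of the
   bounded part, so (2) makes it converge to the tail of P, which vanishes as
   m tends to infinity by dominated convergence. *)

(** * Level sets and bounded functions *)

Lemma measurable_norm_ge d (T : measurableType d) (R : realType) (g : T -> R)
    (r : R) :
  measurable_fun setT g -> measurable [set x | r <= `|g x|].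
Proof.
move=> mg; rewrite -[X in measurable X]setTI; apply: measurable_fun_le => //.
exact: measurableT_comp.
Qed.

Lemma integrable_bounded d (T : measurableType d) (R : realType)
    (m : probability T R) (g : T -> R) (M : R) :
  measurable_fun setT g -> (forall x, `|g x| <= M) ->
  m.-integrable setT (EFin \o g).
Proof.
move=> mg gM; apply: measurable_bounded_integrable => //.
  by rewrite -ge0_fin_numE ?fin_num_measure.
exists M; split; first exact: num_real.
by move=> N MN x _; apply: (le_trans (gM x)); exact: ltW.
Qed.

(** * Integrals under setwise convergence of measures on a fixed space *)

Section setwise_convergence.
Local Open Scope ereal_scope.
Context d (T : measurableType d) (R : realType).
Context (I : Type) (F : set_system I) {FF : ProperFilter F}.
Variables (mu : I -> probability T R) (P : probability T R).
Hypothesis muP : forall B, measurable B -> mu i B @[i --> F] --> P B.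

Import HBNNSimple.

(** A simple function has finitely many values, so its integral is a finite combination, with
    nonnegative coefficients, of measures of level sets. *)
Lemma cvg_sintegral_setwise (h : {nnsfun T >-> R}) :
  sintegral (mu i) h @[i --> F] --> sintegral P h.
Proof.
have sumE (m : {measure set T -> \bar R}) : sintegral m h =
    \sum_(r <- fset_set (range h) | r \in fset_set (range h))
      r%:E * m (h @^-1` [set r]).
  by rewrite sintegralE fsbig_finite ?big_seq//; exact: fimfunP.
rewrite sumE; under eq_fun do rewrite sumE.
apply: cvg_nnesum => r; (rewrite in_fset_set; last exact: fimfunP).
- move=> /set_mem[x _ <-]; apply: nearW => i.
  by rewrite mule_ge0// lee_fin.
- by move=> _; apply: cvgeZl => //; exact: muP.
Qed.

(** Fatou's inequality in open form: some simple [h] below [g] already has [P]-integral above [c],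
    and its integrals converge along [F]. *)
Lemma lt_integral_setwise (g : T -> \bar R) (c : \bar R) :
  (forall x, 0 <= g x) -> c < \int[P]_x g x ->
  \forall i \near F, c < \int[mu i]_x g x.
Proof.
move=> g0; rewrite ge0_integralTE// => /ereal_sup_gt[_ [h hg <-]] ch.
near=> i; apply: (@lt_le_trans _ _ (sintegral (mu i) h)).
  by near: i; exact: (cvg_sintegral_setwise (open_ereal_gt' ch)).
by rewrite ge0_integralTE//; apply: ereal_sup_ubound; exists h.
Unshelve. all: by end_near. Qed.

(** By contraposition: a [P]-integral above [c] would force the same for late [mu i], and a proper
    filter contains an index where both inequalities meet. *)
Lemma le_integral_setwise (D : set T) (g : T -> \bar R) (c : \bar R) :
  (forall x, D x -> 0 <= g x) ->
  (\forall i \near F, \int[mu i]_(x in D) g x <= c) ->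
  \int[P]_(x in D) g x <= c.
Proof.
move=> g0 lec; rewrite leNgt; apply/negP; rewrite integral_mkcond.
move=> /lt_integral_setwise-/(_ (erestrict_ge0 g0)) gtc.
have [i [/= gtci]] := filter_ex (filterI gtc lec).
by rewrite integral_mkcond leNgt gtci.
Qed.

Lemma cvg_integral_bounded_setwise (g : T -> R) (M : R) :
  measurable_fun setT g -> (forall x, (`|g x| <= M)%R) ->
  \int[mu i]_x (g x)%:E @[i --> F] --> \int[P]_x (g x)%:E.
Proof.
move=> mg gM.
have intg (m : probability T R) : m.-integrable setT (EFin \o g).
  exact: integrable_bounded gM.
have intgE (m : probability T R) :
    \int[m]_x (g x)%:E = (fine (\int[m]_x (g x)%:E))%:E.
  by rewrite fineK//; exact: (integrable_fin_num _ (intg m)).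
have intMD (m : probability T R) (s : R) : \int[m]_x (M + s * g x)%:E =
    (M + s * fine (\int[m]_x (g x)%:E))%:E.
  under eq_integral do rewrite EFinD EFinM.
  rewrite integralD//; last 2 first.
  - by apply: (@integrable_bounded _ _ _ _ (cst M) `|M|) => //.
  - exact: (integrableZl _ s (intg m)).
  rewrite integral_cst//= probability_setT mule1 (integralZl _ (intg m))//.
  by rewrite [in LHS]intgE -EFinM -EFinD.
(* Fatou is applied to the nonnegative function [M + s * g]; [s = 1] bounds the integrals of [g]
   from below and [s = -1] from above. *)
have lb (s : R) : `|s|%R = 1%R -> forall e : R, (0 < e)%R ->
    \forall i \near F, (s * fine (\int[P]_x (g x)%:E) - e <
      s * fine (\int[mu i]_x (g x)%:E))%R.
  move=> s1 e e0.
  have : \forall i \near F, (M + s * fine (\int[P]_x (g x)%:E) - e)%:E <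
      \int[mu i]_x (M + s * g x)%:E.
    apply: lt_integral_setwise => [x|].
      rewrite lee_fin -lerBlDl sub0r; have := gM x.
      rewrite -(mul1r `|g x|%R) -s1 -normrM => sgM.
      by rewrite lerNl; apply: le_trans sgM; rewrite -normrN ler_norm.
    by rewrite intMD lte_fin; lra.
  by apply: filterS => i; rewrite intMD lte_fin; lra.
rewrite intgE; apply/fine_cvgP; split.
  by apply: nearW => i; rewrite intgE.
apply/cvgrPdist_lt => e e0.
apply: filterS2 (lb 1%R (normr1 _) e e0) (lb (-1)%R (normrN1 _) e e0) => i /=.
by rewrite !mulN1r !mul1r ltr_norml => ? ?; apply/andP; split; lra.
Qed.

Lemma cvg_integral_bounded_on_setwise (D : set T) (g : T -> R) (M : R) :
  measurable D -> measurable_fun setT g -> (forall x, D x -> (`|g x| <= M)%R) ->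
  \int[mu i]_(x in D) (g x)%:E @[i --> F] --> \int[P]_(x in D) (g x)%:E.
Proof.
move=> mD mg gM; rewrite integral_mkcond.
under eq_fun do rewrite integral_mkcond.
(* The function extended by zero is bounded by [|M|] rather than [M]: if [D] is empty, [M] may be
   negative. *)
rewrite (restrict_EFin g D).
apply: (@cvg_integral_bounded_setwise _ `|M|).
  by apply/(measurable_restrictT g mD); exact: measurable_funTS.
move=> x; rewrite patchE; case: ifPn => [/set_mem Dx|_]; last first.
  by rewrite normr0.
exact: le_trans (gM _ Dx) (ler_norm _).
Qed.

(** * Cutting [f] at level [m] into a bounded head and a tail *)

Variables (f : T -> R) (mf : measurable_fun setT f).

Let tail (m : nat) := [set x | (m%:R <= `|f x|)%R].

Let measurable_tail m : measurable (tail m).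
Proof. exact: measurable_norm_ge. Qed.

Let tailC m x : (~` tail m) x -> (`|f x| <= m%:R)%R.
Proof. by move=> /negP; rewrite -ltNge => /ltW. Qed.

Let integral_tail_split (m : probability T R) (k : nat) (g : T -> \bar R) :
  measurable_fun setT g ->
  \int[m]_x g x = \int[m]_(x in ~` tail k) g x + \int[m]_(x in tail k) g x.
Proof.
move=> mg; rewrite -integral_setU ?setvU//; first exact: measurableC.
by rewrite disj_set_sym; apply/disj_setPS; rewrite setICr.
Qed.

Let mabsf : measurable_fun setT (fun x => `|f x|%:E).
Proof. by apply/measurable_EFinP; exact: measurableT_comp. Qed.

Let integral_head_fin_num (p : probability T R) (m : nat) :
  \int[p]_(x in ~` tail m) (f x)%:E \is a fin_num.
Proof.
rewrite integral_mkcond (restrict_EFin f).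
apply: (integrable_fin_num measurableT).
apply: (@integrable_bounded _ _ _ _ _ m%:R) => [|x].
  apply/(measurable_restrictT _ (measurableC (measurable_tail m))).
  exact: measurable_funTS.
by rewrite patchE; case: ifPn => [/set_mem/tailC//|_]; rewrite normr0.
Qed.

(** The implication from (1) to (2) on a fixed space. The iterated limit enters only through its
    consequence for each [e]: a single level [m] that serves all late [i]. *)
Lemma cvg_integral_setwise :
  (\forall i \near F, (mu i).-integrable setT (EFin \o f)) ->
  (forall e : R, (0 < e)%R -> exists m : nat,
    \forall i \near F, \int[mu i]_(x in tail m) `|f x|%:E <= e%:E) ->
  P.-integrable setT (EFin \o f) /\
  \int[mu i]_x (f x)%:E @[i --> F] --> \int[P]_x (f x)%:E.
Proof.
move=> intmu small.
have intP : P.-integrable setT (EFin \o f).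
  apply/integrableP; split; first exact/measurable_EFinP.
  have [m tail1] := small 1%R ltr01.
  (* The bound [m + 1] is at most [m] from the head, as the total mass is 1, plus 1 from the tail;
     it holds for late [mu i] and passes to [P] by Fatou. *)
  apply: (@le_lt_trans _ _ (m%:R + 1)%:E); last exact: ltry.
  apply: (@le_integral_setwise setT) => [x _|]; first exact: abse_ge0.
  apply: filterS tail1 => i tail1; rewrite (integral_tail_split _ m)//.
  rewrite EFinD leeD//.
  apply: (@le_trans _ _ (\int[mu i]_(x in ~` tail m) (cst m%:R%:E) x)).
    apply: ge0_le_integral => //; first exact: measurableC.
    - exact: measurable_funS mabsf.
    - by move=> x /tailC; rewrite lee_fin.
  rewrite integral_cst//; last exact: measurableC.
  rewrite -[leRHS]mule1 lee_wpmul2l ?lee_fin//=.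
  by apply: probability_le1; exact: measurableC.
split=> //.
have intPE : \int[P]_x (f x)%:E = (fine (\int[P]_x (f x)%:E))%:E.
  by rewrite fineK//; exact: (integrable_fin_num _ intP).
rewrite intPE; apply/fine_cvgP; split.
  by apply: filterS intmu => i /(integrable_fin_num measurableT).
apply/cvgrPdist_le => e e0.
(* One third each for the tail of [P], the tail of [mu i] and the difference of the heads. *)
have e3 : (0 < e / 3)%R by rewrite divr_gt0.
have [m tailm] := small _ e3.
have := @cvg_integral_bounded_on_setwise (~` tail m) f m%:R
  (measurableC (measurable_tail m)) mf (@tailC m).
rewrite -(fineK (integral_head_fin_num P m)).
move=> /fine_cvgP[_ /cvgrPdist_le/(_ _ e3) headm].
have split_dist (p : probability T R) : p.-integrable setT (EFin \o f) ->
    \int[p]_(x in tail m) `|f x|%:E <= (e / 3)%:E ->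
    (`|fine (\int[p]_x (f x)%:E) - fine (\int[p]_(x in ~` tail m) (f x)%:E)|
      <= e / 3)%R.
  move=> intp tailp.
  have intpm : p.-integrable (tail m) (EFin \o f) by exact: integrableS intp.
  have fin_tail := integrable_fin_num (measurable_tail m) intpm.
  rewrite (integral_tail_split _ m); last exact/measurable_EFinP.
  rewrite fineD ?integral_head_fin_num// addrAC subrr add0r -lee_fin -fine_abse//.
  rewrite fineK ?abse_fin_num//; apply: le_trans tailp.
  by apply: le_abse_integral => //; exact/measurable_EFinP/measurable_funTS.
have tailP : \int[P]_(x in tail m) `|f x|%:E <= (e / 3)%:E.
  by apply: le_integral_setwise tailm => x _; rewrite lee_fin.
apply: filterS3 intmu tailm headm => i inti taili /=.
move: (split_dist _ intP tailP) (split_dist _ inti taili).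
rewrite !ler_norml => /andP[? ?] /andP[? ?] /andP[? ?].
by apply/andP; split; lra.
Qed.

Lemma cvg_integral_tail : P.-integrable setT (EFin \o f) ->
  \int[P]_(x in tail m) `|f x|%:E @[m --> \oo] --> 0.
Proof.
move=> intP; under eq_fun do rewrite integral_mkcond.
(* The limit 0 is written as the integral of the zero function, to which the truncations converge
   pointwise: at [x] they vanish once [m] exceeds [|f x|]. *)
rewrite -[X in nbhs X](@integral0 _ _ _ P setT).
apply: (@dominated_cvg _ _ _ _ _ measurableT _ _ (fun x => `|f x|%:E)) => //.
- by move=> m; apply/(measurable_restrictT _ (measurable_tail m));
    exact: measurable_funS mabsf.
- move=> x _; apply: cvg_near_cst.
  have [N _ Nf] := nbhs_infty_gtr `|f x|%R.
  exists N => // m /Nf /= fm; rewrite patchE memNset//=.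
  by apply/negP; rewrite -ltNge.
- exact: integrable_abse intP.
- move=> m x _; rewrite patchE; case: ifPn => _; rewrite ?abse0 ?lee_fin//.
  by rewrite /= normr_id.
Qed.

Lemma cvg_integral_tail_setwise (m : nat) : (forall x, 0 <= f x)%R ->
  P.-integrable setT (EFin \o f) ->
  \int[mu i]_x (f x)%:E @[i --> F] --> \int[P]_x (f x)%:E ->
  \int[mu i]_(x in tail m) `|f x|%:E @[i --> F] -->
  \int[P]_(x in tail m) `|f x|%:E.
Proof.
move=> f0 intP cvgf.
have absE (p : probability T R) : \int[p]_(x in tail m) `|f x|%:E =
    \int[p]_x (f x)%:E - \int[p]_(x in ~` tail m) (f x)%:E.
  rewrite (integral_tail_split _ m); last exact/measurable_EFinP.
  rewrite addeAC subee ?add0e; last exact: integral_head_fin_num.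
  by apply: eq_integral => x _; rewrite ger0_norm.
rewrite absE; under eq_fun do rewrite absE.
(* The head of [P] is finite, so the difference of the limits is not of the form oo - oo. *)
apply: cvgeB => //.
  by rewrite fin_num_adde_defl// fin_numN integral_head_fin_num.
apply: (@cvg_integral_bounded_on_setwise (~` tail m) f m%:R) => //.
- exact: measurableC.
- exact: tailC.
Qed.

End setwise_convergence.

(** * Change of variables along a measurable map *)

Section distribution_transfer.
Local Open Scope ereal_scope.
Context d d' (S : measurableType d) (T : measurableType d') (R : realType).
Variables (nu : probability S R) (X : {mfun S >-> T}) (g : T -> \bar R).
Hypothesis mg : measurable_fun setT g.

Lemma integral_distribution_comp :
  \int[distribution nu X]_y g y = \int[nu]_x g (X x).
Proof.
rewrite integralE [RHS]integralE; congr (_ - _).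
- rewrite ge0_integral_pushforward//; last exact: measurable_funepos.
  by rewrite preimage_setT -funepos_comp.
- rewrite ge0_integral_pushforward//; last exact: measurable_funeneg.
  by rewrite preimage_setT -funeneg_comp.
Qed.

Lemma integrable_distribution :
  (distribution nu X).-integrable setT g <-> nu.-integrable setT (g \o X).
Proof.
have absE : \int[distribution nu X]_y `|g y| = \int[nu]_x `|(g \o X) x|.
  by rewrite ge0_integral_pushforward//; exact: measurableT_comp.
split=> /integrableP[_ gfin]; apply/integrableP; split=> //.
- exact: measurableT_comp.
- by rewrite -absE.
- by rewrite absE.
Qed.

End distribution_transfer.

(** Properness allows picking an index from eventual statements and makes the inner limits
    unique. *)
Lemma natgt_oo_proper (k : nat) : ProperFilter (natgt_oo k).
Proof.
apply: subset_filter_proper => A [N _ NA] noA; apply: noA.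
exists (maxn N k.+1); split; first by rewrite /= leq_max ltnSn orbT.
by apply: NA; rewrite /= leq_maxl.
Qed.

(** The trace sigma-algebra consists of preimages under the inclusion, which is thus measurable; the
    projection is then checked coordinatewise. *)
Lemma measurable_trace_proj d (E : measurableType d) (k : nat) (j : natgt k)
    (Omega : set ((sval j).-tuple E)) (Omega0 : Omega !=set0) :
  measurable_fun setT (@trace_proj _ E k j Omega Omega0).
Proof.
have mval : measurable_fun setT
    (@trace_val _ Omega Omega0 : trace_space Omega0 -> _).
  by move=> _ B mB; exists B.
apply: measurableT_comp mval => /=.
apply/measurable_fun_tnthP => i.
rewrite (_ : _ \o _ = fun x => tnth x (widen_ord (ltnW (svalP j)) i)).
  exact: measurable_tnth.
by apply/funext => x; rewrite /= /first_coords tnth_mktuple.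
Qed.

(** * Reduction of the theorem to a fixed space *)

Theorem theorem1p2 (d : measure_display) (E : measurableType d) (R : realType)
    (k : nat) (n' : natgt k -> natgt k)
    (Omega : forall n : natgt k, set ((sval (n' n)).-tuple E))
    (Omega0 : forall n : natgt k, Omega n !=set0)
    (nu : forall n : natgt k, probability (trace_space (Omega0 n)) R)
    (P : probability (k.-tuple E) R)
    (nuP : forall B : set (k.-tuple E), measurable B ->
       nu n [set x | B (trace_proj (Omega0 n) x)] @[n --> natgt_oo k] --> P B)
    (f : k.-tuple E -> R) (mf : measurable_fun setT f) :
  (condition1 nu f -> condition2 nu P f) /\
  ((forall x, 0 <= f x) -> (condition1 nu f <-> condition2 nu P f)).
Proof.
have FF := natgt_oo_proper k.
pose X n : {mfun trace_space (Omega0 n) >-> k.-tuple E} :=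
  mfun_Sub (mem_set (@measurable_trace_proj _ E k _ _ (Omega0 n))).
(* The spaces [Omega n] vary with [n]; pushing [nu n] forward along the projection places all the
   measures on the space of [P]. *)
pose mu n : probability (k.-tuple E) R := distribution (nu n) (X n).
have muP (B : set (k.-tuple E)) : measurable B ->
    mu n B @[n --> natgt_oo k] --> P B by exact: nuP.
have mEf : measurable_fun setT (EFin \o f) by exact/measurable_EFinP.
have integral_nuE n : (\int[nu n]_x (f (trace_proj (Omega0 n) x))%:E =
    \int[mu n]_x (f x)%:E)%E.
  by rewrite integral_distribution_comp.
have integrable_nuE n : (mu n).-integrable setT (EFin \o f) <->
    (nu n).-integrable setT (EFin \o f \o trace_proj (Omega0 n)).
  exact: integrable_distribution.
have tailE m n : (\int[nu n]_(x in
      [set x | (m%:R <= `|f (trace_proj (Omega0 n) x)|)%R])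
       `|f (trace_proj (Omega0 n) x)|%:E =
    \int[mu n]_(x in [set x | (m%:R <= `|f x|)%R]) `|f x|%:E)%E.
  rewrite ge0_integral_pushforward//.
  - exact: measurable_norm_ge.
  - by apply/measurable_funTS/measurable_EFinP; exact: measurableT_comp.
have cond12 : condition1 nu f -> condition2 nu P f.
  move=> [intnu cvgtail tail0].
  have [||intP cvgf] := cvg_integral_setwise muP mf.
  - by apply: filterS intnu => n /integrable_nuE.
  - move=> e e0.
    have tail_lt := tail0 _ (open_ereal_lt' (e0 : (0 < e%:E)%E)).
    (* The level [m] must satisfy both conditions: the value of [lim] below [e] says something about
       the tails only where the inner limit exists. *)
    have [m [cvgm ltm]] := filter_ex (filterI cvgtail tail_lt).
    exists m; apply: (@filterS _ (natgt_oo k)) (cvgm _ (open_ereal_lt' ltm)).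
    by move=> n /=; rewrite tailE => /ltW.
  by split=> //; under eq_fun do rewrite integral_nuE.
split=> // f0; split=> // -[intP cvgnu].
have cvgf : (\int[mu n]_x (f x)%:E)%E @[n --> natgt_oo k] -->
    (\int[P]_x (f x)%:E)%E.
  by move: cvgnu; under eq_fun do rewrite integral_nuE.
have cvgtail m : (\int[nu n]_(x in
      [set x | (m%:R <= `|f (trace_proj (Omega0 n) x)|)%R])
       `|f (trace_proj (Omega0 n) x)|%:E)%E @[n --> natgt_oo k] -->
    (\int[P]_(x in [set x | (m%:R <= `|f x|)%R]) `|f x|%:E)%E.
  under eq_fun do rewrite tailE.
  exact: cvg_integral_tail_setwise.
split.
(* Convergence to a finite limit makes the integrals of [f] eventually finite, which yields
   integrability. *)
- move: cvgf; rewrite -(fineK (integrable_fin_num measurableT intP)).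
  move=> /fine_cvgP[+ _]; apply: filterS => n finf.
  apply/integrable_nuE/integrableP; split=> //.
  by rewrite integral_fin_num_abs.
- by apply: nearW => m; apply: cvgP (cvgtail m).
(* Each inner limit is identified as the tail of [P], so the outer limit is that of
   [cvg_integral_tail]. *)
- under eq_fun => m do rewrite (cvg_lim (@ereal_hausdorff R) (cvgtail m)).
  exact: cvg_integral_tail.
Qed.
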